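(* Let $p$ be a prime and let $\mathfrak A(s_0)=\langle\mathbb F_p,\mathcal S,\mathbb F_p,S,O,s_0\rangle$ be an automaton all of whose states are reachable from $s_0$. Suppose that the automaton function $f=f_{\mathfrak A(s_0)}\colon\mathbb Z_p\to\mathbb Z_p$ maps $\mathbb N_0$ into $\mathbb N_0$, that $f$ is two times differentiable on $\mathbb Z_p$, and that $f''$ has no more than a finite number of zeros in $\mathbb N_0$. Then the automaton $\mathfrak A(s_0)$ is absolutely transitive.
   Context: Throughout, $\mathbb F_p=\{0,1,\ldots,p-1\}$ is used as an alphabet, $\mathbb N_0=\{0,1,2,\ldots\}$, and $\mathbb Z_p$ is the space of $p$-adic integers with the $p$-adic metric; $x=\sum_{i\ge 0}\chi_i p^i\in\mathbb Z_p$ (with $\chi_i\in\mathbb F_p$) is identified with the infinite word with letters $\chi_0,\chi_1,\chi_2,\ldots$. Differentiability is in the $p$-adic sense (limits of difference quotients in $\mathbb Q_p$ with respect to the $p$-adic absolute value); derivatives take values in $\mathbb Q_p$, and $f''$ is the derivative of $f'$. Automaton: a tuple $\mathfrak A(s_0)=\langle\mathbb F_p,\mathcal S,\mathbb F_p,S,O,s_0\rangle$ where $\mathcal S$ is a non-empty, possibly infinite, set of states, $S\colon\mathbb F_p\times\mathcal S\to\mathcal S$ is the state transition function, $O\colon\mathbb F_p\times\mathcal S\to\mathbb F_p$ is the output function, and $s_0\in\mathcal S$ is the initial state. For $s\in\mathcal S$, $\mathfrak A(s)$ denotes the same automaton with initial state $s$ instead of $s_0$. A state $t$ is reachable from $s$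 if it is the state reached from $s$ after feeding some finite (possibly empty) input word; $\mathcal S_{\mathfrak A(s)}$ denotes the set of all states reachable from $s$. Automaton function: for an input $x=\sum_{i\ge0}\chi_ip^i$ and initial state $s$, put $s^{(0)}=s$, $s^{(i+1)}=S(\chi_i,s^{(i)})$ and $\xi_i=O(\chi_i,s^{(i)})$ for $i=0,1,2,\ldots$; then $f_{\mathfrak A(s)}(x)=\sum_{i\ge0}\xi_ip^i$. For $n\ge 1$ let $W_n$ be the set of words of length $n$ over $\mathbb F_p$, and let $f_{n,\mathfrak A(s)}\colon W_n\to W_n$ be the map sending the input word with successive letters $\chi_0,\ldots,\chi_{n-1}$ (fed in this order) to the output word with letters $\xi_0,\ldots,\xi_{n-1}$. Absolute transitivity: a family $\mathcal F$ of maps of a finite non-empty set $M$ into itself is transitive if for every $(a,b)\in M\times M$ there is $g\in\mathcal F$ with $g(a)=b$. The automaton $\mathfrak A(s_0)$ is absolutely transitive if for every $s\in\mathcal S$ and every $n\in\{1,2,3,\ldots\}$ the family $f_{n,\mathfrak A(t)}$, $t\in\mathcal S_{\mathfrak A(s)}$, is transitive on $W_n$. *)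

(* Defs.v *)
From HB Require Import structures.
From mathcomp Require Import all_boot all_order all_algebra.
From mathcomp Require Import generic_quotient fraction.
From mathcomp Require Import boolp classical_sets functions cardinality.

Set Implicit Arguments.
Unset Strict Implicit.
Unset Printing Implicit Defensive.

Import Order.TTheory GRing.Theory Num.Theory.

(* A p-adic integer is its digit word chi_0, chi_1, ... (least significant
   first).  The primality proof is a parameter of the type because the ring
   structure below is an integral domain only for prime p. *)
Record padic_int (p : nat) (p_pr : prime p) :=
  PadicInt { digit : nat -> 'I_p }.

Arguments PadicInt {p} p_pr.

HB.instance Definition _ p (p_pr : prime p) := gen_eqMixin (padic_int p_pr).
HB.instance Definition _ p (p_pr : prime p) := gen_choiceMixin (padic_int p_pr).

Section PadicInt.
Variables (p : nat) (p_pr : prime p).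
Local Notation Zp := (padic_int p_pr).
Implicit Types (x y z : Zp) (n m k : nat).

Let p_gt0 : 0 < p. Proof. exact: prime_gt0. Qed.
Let p_gt1 : 1 < p. Proof. exact: prime_gt1. Qed.
Let pX_gt0 n : 0 < p ^ n. Proof. by rewrite expn_gt0 p_gt0. Qed.

Definition trunc x n : nat := \sum_(i < n) digit x i * p ^ i.

Lemma truncS x n : trunc x n.+1 = trunc x n + digit x n * p ^ n.
Proof. by rewrite /trunc big_ord_recr. Qed.

Lemma trunc0 x : trunc x 0 = 0.
Proof. by rewrite /trunc big_ord0. Qed.

Lemma trunc_lt x n : trunc x n < p ^ n.
Proof.
elim: n => [|n IHn]; first by rewrite trunc0.
rewrite truncS expnS; apply: leq_trans (_ : (digit x n).+1 * p ^ n <= _).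
  by rewrite mulSn ltn_add2r.
by rewrite leq_mul2r ltn_ord orbT.
Qed.

Lemma trunc_mod x m n : m <= n -> trunc x n %% p ^ m = trunc x m.
Proof.
move=> /subnKC <-; elim: (n - m) => [|k IHk].
  by rewrite addn0 modn_small ?trunc_lt.
by rewrite addnS truncS expnD mulnCA -modnDmr modnMr addn0.
Qed.

Lemma digit_trunc x n : digit x n = trunc x n.+1 %/ p ^ n :> nat.
Proof. by rewrite truncS addnC divnMDl // divn_small ?addn0 ?trunc_lt. Qed.

Lemma trunc_inj x y : (forall n, trunc x n = trunc y n) -> x = y.
Proof.
move=> eq_xy; have: digit x = digit y.
  by apply/funext => n; apply: ord_inj; rewrite !digit_trunc eq_xy.
by case: x y {eq_xy} => [u] [v] /= ->.
Qed.

(* The p-adic limit of a sequence f of naturals that is coherent, i.e.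
   f n.+1 = f n %[mod p ^ n]. *)
Definition coherent (f : nat -> nat) := forall n, f n.+1 = f n %[mod p ^ n].

Definition padic_lim (f : nat -> nat) : Zp :=
  PadicInt p_pr (fun n => Ordinal (ltn_pmod (f n.+1 %/ p ^ n) p_gt0)).

Lemma trunc_lim f n : coherent f -> trunc (padic_lim f) n = f n %% p ^ n.
Proof.
move=> cf; elim: n => [|n IHn]; first by rewrite trunc0 modn1.
rewrite truncS IHn -cf /= [RHS](divn_eq _ (p ^ n)) addnC.
congr (_ + _); first by rewrite modn_divl expnS.
by rewrite modn_dvdm // expnS dvdn_mull.
Qed.

Lemma coherent_trunc x : coherent (trunc x).
Proof. by move=> n; rewrite trunc_mod // modn_small ?trunc_lt. Qed.

Definition padic_nat n : Zp := padic_lim (fun=> n).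
Definition padic_add x y : Zp := padic_lim (fun n => trunc x n + trunc y n).
Definition padic_mul x y : Zp := padic_lim (fun n => trunc x n * trunc y n).
Definition padic_opp x : Zp := padic_lim (fun n => p ^ n - trunc x n).

Lemma trunc_nat m n : trunc (padic_nat m) n = m %% p ^ n.
Proof. exact: trunc_lim. Qed.

Lemma trunc_add x y n :
  trunc (padic_add x y) n = (trunc x n + trunc y n) %% p ^ n.
Proof.
by apply: trunc_lim => k; rewrite -modnDm !coherent_trunc modnDm.
Qed.

Lemma trunc_mul x y n :
  trunc (padic_mul x y) n = (trunc x n * trunc y n) %% p ^ n.
Proof.
by apply: trunc_lim => k; rewrite -modnMm !coherent_trunc modnMm.
Qed.

Lemma trunc_opp x n : trunc (padic_opp x) n = (p ^ n - trunc x n) %% p ^ n.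
Proof.
apply: trunc_lim => k; apply/eqP; rewrite -(eqn_modDr (trunc x k.+1)).
rewrite subnK; last exact/ltnW/trunc_lt.
rewrite -[X in _ == X](modnDmr _ (trunc x k.+1)) coherent_trunc modnDmr.
rewrite subnK; last exact/ltnW/trunc_lt.
by rewrite expnS modnMl modnn.
Qed.

Let addA : associative padic_add.
Proof.
by move=> x y z; apply: trunc_inj => n; rewrite !trunc_add modnDmr modnDml addnA.
Qed.
Let addC : commutative padic_add.
Proof. by move=> x y; apply: trunc_inj => n; rewrite !trunc_add addnC. Qed.
Let add0 : left_id (padic_nat 0) padic_add.
Proof.
move=> x; apply: trunc_inj => n.
by rewrite trunc_add trunc_nat modnDml add0n modn_small ?trunc_lt.
Qed.
Let addN : left_inverse (padic_nat 0) padic_opp padic_add.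
Proof.
move=> x; apply: trunc_inj => n.
rewrite trunc_add trunc_nat trunc_opp modnDml mod0n.
by rewrite subnK ?modnn //; exact/ltnW/trunc_lt.
Qed.

HB.instance Definition _ := GRing.isZmodule.Build Zp addA addC add0 addN.

Let mulA : associative padic_mul.
Proof.
by move=> x y z; apply: trunc_inj => n; rewrite !trunc_mul modnMmr modnMml mulnA.
Qed.
Let mulC : commutative padic_mul.
Proof. by move=> x y; apply: trunc_inj => n; rewrite !trunc_mul mulnC. Qed.
Let mul1 : left_id (padic_nat 1) padic_mul.
Proof.
move=> x; apply: trunc_inj => n.
by rewrite trunc_mul trunc_nat modnMml mul1n modn_small ?trunc_lt.
Qed.
Let mulDl : left_distributive padic_mul padic_add.
Proof.
move=> x y z; apply: trunc_inj => n.
by rewrite !(trunc_add, trunc_mul) modnMml modnDm mulnDl.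
Qed.
Let oner_neq0 : padic_nat 1 != padic_nat 0.
Proof.
apply/eqP => /(congr1 (trunc^~ 1)); rewrite !trunc_nat expn1 mod0n.
by rewrite modn_small.
Qed.

HB.instance Definition _ :=
  GRing.Zmodule_isComNzRing.Build Zp mulA mulC mul1 mulDl oner_neq0.

Lemma truncD x y n : trunc (x + y)%R n = (trunc x n + trunc y n) %% p ^ n.
Proof. exact: trunc_add. Qed.

Lemma truncM x y n : trunc (x * y)%R n = (trunc x n * trunc y n) %% p ^ n.
Proof. exact: trunc_mul. Qed.

Lemma trunc0r n : trunc (0%R : Zp) n = 0.
Proof. by rewrite trunc_nat mod0n. Qed.

Lemma truncMn m n : trunc (m%:R%R : Zp) n = m %% p ^ n.
Proof.
elim: m => [|m IHm]; first by rewrite trunc0r mod0n.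
by rewrite mulrS truncD IHm trunc_nat modnDm.
Qed.

Lemma digit_nat m n : digit (m%:R%R : Zp) n = m %/ p ^ n %% p :> nat.
Proof. by rewrite digit_trunc truncMn expnS modn_divl. Qed.

Definition padic_unit : {pred Zp} := fun x => `[< exists y, (y * x)%R = 1%R >].
Definition padic_inv x : Zp := xget x [set y : Zp | (y * x)%R = 1%R].

Let mulVx : {in padic_unit, left_inverse 1%R padic_inv *%R}.
Proof. by move=> x /asboolP exy; have := xgetPex x exy. Qed.
Let unitPl x y : (y * x)%R = 1%R -> padic_unit x.
Proof. by move=> yx; apply/asboolP; exists y. Qed.
Let invr_out : {in [predC padic_unit], padic_inv =1 id}.
Proof.
move=> x /negP nu; rewrite /padic_inv; case: xgetP => // y _ yx.
by case: nu; apply: unitPl yx.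
Qed.

HB.instance Definition _ :=
  GRing.ComNzRing_hasMulInverse.Build Zp mulVx unitPl invr_out.

Lemma padic_neq0P x : x != 0%R -> exists n, digit x n != 0 :> nat.
Proof.
apply: contra_neqP => ndig; apply: trunc_inj => n; rewrite trunc0r /trunc.
apply: big1 => i _; case: (digit x i =P 0 :> nat) => [-> // | /eqP dxi].
by case: ndig; exists i.
Qed.

(* The index of the first nonzero digit; the value at 0 is irrelevant. *)
Definition padic_val x : nat :=
  if pselect (exists n, digit x n != 0 :> nat) is left x_neq0
  then ex_minn x_neq0 else 0.

Lemma padic_val_ge x m : x != 0%R -> (m <= padic_val x) = (trunc x m == 0).
Proof.
move=> /padic_neq0P xn; rewrite /padic_val; case: pselect => // {}xn.
case: ex_minnP => v xv minv; apply/idP/eqP => [le_mv | xm0].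
  apply: big1 => i _; case: (digit x i =P 0 :> nat) => [-> // | /eqP dxi].
  by have:= leq_trans le_mv (minv _ dxi); rewrite leqNgt ltn_ord.
rewrite leqNgt; apply: contra xv => lt_vm; rewrite digit_trunc.
by rewrite -(trunc_mod x lt_vm) xm0 mod0n div0n.
Qed.

Lemma padic_val_eq x k : trunc x k = 0 -> trunc x k.+1 != 0 ->
  x != 0%R /\ padic_val x = k.
Proof.
move=> xk xk1; have x0 : x != 0%R by apply: contraNneq xk1 => ->; rewrite trunc0r.
split=> //; apply/eqP; rewrite eqn_leq padic_val_ge // xk eqxx andbT.
by rewrite -ltnS ltnNge padic_val_ge.
Qed.

Lemma logn_trunc x n : x != 0%R -> padic_val x < n ->
  0 < trunc x n /\ logn p (trunc x n) = padic_val x.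
Proof.
move=> x0 lt_vn; have xn0 : 0 < trunc x n.
  by rewrite lt0n -padic_val_ge // -ltnNge.
split=> //; apply/eqP; rewrite eqn_leq -ltnS ltnNge -!pfactor_dvdn //.
rewrite /dvdn !trunc_mod ?(ltnW lt_vn) // -!padic_val_ge //.
by rewrite ltnn leqnn.
Qed.

Lemma padic_valM_subproof x y : x != 0%R -> y != 0%R ->
  (x * y)%R != 0%R /\ padic_val (x * y)%R = padic_val x + padic_val y.
Proof.
move=> x0 y0; set a := padic_val x; set b := padic_val y.
have [|xn lx] := @logn_trunc x (a + b).+1 x0; first by rewrite ltnS leq_addr.
have [|yn ly] := @logn_trunc y (a + b).+1 y0; first by rewrite ltnS leq_addl.
have lxy : logn p (trunc x (a + b).+1 * trunc y (a + b).+1) = a + b.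
  by rewrite lognM // lx ly.
apply: padic_val_eq.
  rewrite -(@trunc_mod _ _ (a + b).+1) // truncM modn_dvdm ?dvdn_exp2l //.
  by apply/eqP; rewrite -/(dvdn _ _) pfactor_dvdn ?muln_gt0 ?xn // lxy.
rewrite truncM -/(dvdn _ _) pfactor_dvdn ?muln_gt0 ?xn // lxy.
by rewrite ltnn.
Qed.

Let mulf_eq0_subproof x y :
  (x * y)%R = 0%R -> (x == 0%R) || (y == 0%R).
Proof.
move=> /eqP; apply: contraTT; rewrite negb_or => /andP[x0 y0].
by case: (padic_valM_subproof x0 y0).
Qed.

HB.instance Definition _ :=
  GRing.ComUnitRing_isIntegral.Build Zp mulf_eq0_subproof.

End PadicInt.

Arguments padic_nat {p} p_pr n.

Notation padic p_pr := {fraction (padic_int p_pr)}.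

Notation "x %:Qp" := (FracField.tofrac x) (at level 2, format "x %:Qp").

Local Open Scope classical_set_scope.
Local Open Scope ring_scope.

Section AbsoluteValue.
Variables (p : nat) (p_pr : prime p).
Local Notation Zp := (padic_int p_pr).
Local Notation Qp := (padic p_pr).

Definition zpabs (x : Zp) : rat :=
  if x == 0 then 0 else p%:R ^- padic_val x.

(* |a / b|_p = |a|_p / |b|_p, for the representative a / b of q chosen by the
   quotient {fraction _}; see qpabs_div for the independence of the choice. *)
Definition qpabs (q : Qp) : rat :=
  let r : {ratio Zp} := repr q in zpabs \n_r / zpabs \d_r.

Let p_neq0 : p%:R != 0 :> rat.
Proof. by rewrite pnatr_eq0 -lt0n prime_gt0. Qed.

Lemma zpabs0 : zpabs 0 = 0.
Proof. by rewrite /zpabs eqxx. Qed.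

Lemma zpabs_eq0 x : (zpabs x == 0) = (x == 0).
Proof.
rewrite /zpabs; have [_|_] := eqVneq x 0; first by rewrite eqxx.
by apply/negbTE; rewrite invr_eq0 expf_neq0.
Qed.

Lemma zpabs_ge0 x : 0 <= zpabs x.
Proof. by rewrite /zpabs; case: ifP => // _; rewrite invr_ge0 exprn_ge0. Qed.

Lemma zpabs1 : zpabs 1 = 1.
Proof.
rewrite /zpabs oner_eq0; have [|//|_ ->] := @padic_val_eq _ p_pr 1 0.
- exact: trunc0.
- by rewrite (truncMn p_pr 1 1) modn_small // expn1 prime_gt1.
by rewrite expr0 invr1.
Qed.

Lemma zpabsM x y : zpabs (x * y) = zpabs x * zpabs y.
Proof.
rewrite /zpabs mulf_eq0.
have [_|x0] := eqVneq x 0; first by rewrite mul0r.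
have [_|y0] := eqVneq y 0; first by rewrite mulr0.
by have [_ ->] := padic_valM_subproof x0 y0; rewrite exprD invfM.
Qed.

Lemma zpabsD x y : zpabs (x + y) <= Num.max (zpabs x) (zpabs y).
Proof.
have [->|x0] := eqVneq x 0; first by rewrite add0r le_max lexx orbT.
have [->|y0] := eqVneq y 0; first by rewrite addr0 le_max lexx.
have [->|s0] := eqVneq (x + y) 0; first by rewrite zpabs0 le_max zpabs_ge0.
rewrite /zpabs (negbTE x0) (negbTE y0) (negbTE s0) le_max.
have p1 : 1 < p%:R :> rat by rewrite ltr1n prime_gt1.
rewrite !lef_pV2 ?posrE ?exprn_gt0 ?(lt_trans ltr01 p1) // !ler_eXn2l //.
rewrite -geq_min padic_val_ge // truncD.
set m := minn _ _.
suff [/eqP-> /eqP->] : trunc x m == 0%N /\ trunc y m == 0%N by rewrite mod0n.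
by rewrite -!padic_val_ge // geq_minl geq_minr.
Qed.

Lemma zpabs_nat n : (0 < n)%N -> zpabs n%:R = p%:R ^- logn p n.
Proof.
move=> n0; rewrite /zpabs; have [||/negbTE-> -> //] :=
  @padic_val_eq _ p_pr n%:R (logn p n).
  by rewrite truncMn; apply/eqP; rewrite -/(dvdn _ _) pfactor_dvdn.
by rewrite truncMn -/(dvdn _ _) pfactor_dvdn // ltnn.
Qed.

Let fraction_div (r : {ratio Zp}) :
  (\n_r)%:Qp / (\d_r)%:Qp = \pi_({fraction Zp})%qT r.
Proof.
have d0 := denom_ratioP r.
rewrite /GRing.inv /GRing.mul /= !piE /FracField.invf /FracField.mulf.
rewrite !numden_Ratio ?oner_neq0 //.
by rewrite mulr1 mul1r Ratio_numden.
Qed.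

Lemma qpabs_div (x y : Zp) : y != 0 -> qpabs (x%:Qp / y%:Qp) = zpabs x / zpabs y.
Proof.
move=> y0; rewrite /qpabs; set r := repr _.
have d0 : \d_r != 0 by apply: denom_ratioP.
have Er : (\n_r)%:Qp / (\d_r)%:Qp = x%:Qp / y%:Qp by rewrite fraction_div ?reprK.
have /(congr1 zpabs) : \n_r * y = x * \d_r.
  apply/eqP; rewrite -tofrac_eq !tofracM -eqr_div ?tofrac_eq0 // Er //.
rewrite !zpabsM => E; apply/eqP.
by rewrite eqr_div ?zpabs_eq0 // E.
Qed.

Lemma padic_fracP (q : Qp) :
  exists x y : Zp, y != 0 /\ q = x%:Qp / y%:Qp.
Proof.
exists \n_(repr q), \d_(repr q); split; first exact: denom_ratioP.
by rewrite fraction_div reprK.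
Qed.

Lemma qpabs_int (x : Zp) : qpabs x%:Qp = zpabs x.
Proof.
by rewrite -[x%:Qp]divr1 -tofrac1 qpabs_div ?oner_neq0 // zpabs1 divr1.
Qed.

Lemma qpabs_eq0 (q : Qp) : (qpabs q == 0) = (q == 0).
Proof.
have [x [y [y0 ->]]] := padic_fracP q; rewrite qpabs_div //.
by rewrite !mulf_eq0 !invr_eq0 !zpabs_eq0 !tofrac_eq0.
Qed.

Lemma qpabs_ge0 (q : Qp) : 0 <= qpabs q.
Proof. by rewrite divr_ge0 ?zpabs_ge0. Qed.

Lemma qpabsM (q r : Qp) : qpabs (q * r) = qpabs q * qpabs r.
Proof.
have [a [b [b0 ->]]] := padic_fracP q; have [c [d [d0 ->]]] := padic_fracP r.
by rewrite mulf_div -!tofracM !qpabs_div ?mulf_neq0 // !zpabsM mulf_div.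
Qed.

Lemma qpabsD (q r : Qp) : qpabs (q + r) <= Num.max (qpabs q) (qpabs r).
Proof.
have [a [b [b0 ->]]] := padic_fracP q; have [c [d [d0 ->]]] := padic_fracP r.
have zpgt0 (z : Zp) : z != 0 -> 0 < zpabs z.
  by move=> z0; rewrite lt_def zpabs_eq0 z0 zpabs_ge0.
rewrite addf_div ?tofrac_eq0 // -!tofracM -tofracD !qpabs_div ?mulf_neq0 //.
rewrite ler_pdivrMr ?zpgt0 ?mulf_neq0 // (le_trans (zpabsD _ _)) //.
rewrite !zpabsM maxr_pMl ?mulr_ge0 ?zpabs_ge0 //.
rewrite mulrA divfK ?zpabs_eq0 //.
by rewrite [X in _ <= Num.max _ X]mulrCA divfK ?zpabs_eq0 // [zpabs b * _]mulrC.
Qed.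

Lemma qpabsN (q : Qp) : qpabs (- q) = qpabs q.
Proof.
apply/eqP; rewrite -(@eqrXn2 _ 2) ?qpabs_ge0 //.
by rewrite !expr2 -!qpabsM mulrNN.
Qed.

End AbsoluteValue.

Section Derivative.
Variables (p : nat) (p_pr : prime p).
Local Notation Zp := (padic_int p_pr).
Local Notation Qp := (padic p_pr).

(* l is the p-adic limit of the difference quotients of g at x; x and y range
   over Z_p while quotients, values of g and l lie in Q_p. *)
Definition is_padic_derive (g : Zp -> Qp) (x : Zp) (l : Qp) : Prop :=
  forall eps : rat, 0 < eps ->
    exists2 delta : rat, 0 < delta &
      forall y : Zp, y != x -> zpabs (y - x) < delta ->
        qpabs ((g y - g x) / (y%:Qp - x%:Qp) - l) < eps.

Lemma is_padic_derive_unique g x l1 l2 :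
  is_padic_derive g x l1 -> is_padic_derive g x l2 -> l1 = l2.
Proof.
move=> d1 d2; apply/eqP; rewrite -subr_eq0 -qpabs_eq0; apply/negPn/negP => ne0.
have eps0 : 0 < qpabs (l1 - l2) by rewrite lt_def ne0 qpabs_ge0.
have [a a0 Ha] := d1 _ eps0; have [b b0 Hb] := d2 _ eps0.
pose c := Num.min a b; have c0 : 0 < c by rewrite lt_min a0.
pose n := Num.bound c^-1; pose y : Zp := x + (p ^ n)%:R.
have pn0 : (0 < p ^ n)%N by rewrite expn_gt0 prime_gt0.
have yx : zpabs (y - x) < c.
  rewrite /y addrC addrA addNr add0r zpabs_nat // pfactorK //.
  rewrite invf_plt ?posrE ?exprn_gt0 ?ltr0n ?prime_gt0 //.
  have := archi_boundP (_ : 0 <= c^-1); rewrite invr_ge0 ltW // => /(_ isT).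
  move/lt_le_trans; apply; rewrite -natrX ler_nat ltnW //.
  by rewrite ltn_expl // prime_gt1.
have y_x : y != x.
  rewrite -subr_eq0 -zpabs_eq0 /y addrC addrA addNr add0r zpabs_nat //.
  by rewrite invr_eq0 expf_neq0 // pnatr_eq0 -lt0n prime_gt0.
have /andP[ya yb] : (zpabs (y - x) < a) && (zpabs (y - x) < b).
  by rewrite -lt_min.
have := Ha y y_x ya; have := Hb y y_x yb; set t := _ / _ => tb ta.
have := qpabsD (t - l2) (- (t - l1)).
rewrite qpabsN opprB addrC subrKA => /le_lt_trans.
by move=> /(_ (qpabs (l1 - l2))); rewrite gt_max ta tb ltxx => /(_ isT).
Qed.

End Derivative.

Record automaton (p : nat) := Automaton {
  state : Type;
  trans : 'I_p -> state -> state;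
  outp : 'I_p -> state -> 'I_p;
  init : state }.

Section Automaton.
Variables (p : nat) (A : automaton p).
Implicit Types (s t : state A).

Definition run s (w : seq 'I_p) : state A :=
  foldl (fun s' a => trans a s') s w.

Definition reachable s : set (state A) := [set t | exists w, run s w = t].

Fixpoint state_at s (u : nat -> 'I_p) (i : nat) : state A :=
  if i is j.+1 then trans (u j) (state_at s u j) else s.

Definition automaton_fun (p_pr : prime p) s (x : padic_int p_pr) :
    padic_int p_pr :=
  PadicInt p_pr (fun i => outp (digit x i) (state_at s (digit x) i)).

Definition word_fun (n : nat) s (w : n.-tuple 'I_p) : n.-tuple 'I_p :=
  [tuple outp (tnth w i) (run s (take i w)) | i < n].

Definition transitive_family (M : finType) (F : set (M -> M)) : Prop :=
  forall a b : M, exists2 g, F g & g a = b.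

Definition absolutely_transitive : Prop :=
  forall s n, (1 <= n)%N ->
    transitive_family [set @word_fun n t | t in reachable s].

Lemma state_at_run s u i : state_at s u i = run s (mkseq u i).
Proof.
by elim: i => // i IHi; rewrite mkseqS /run foldl_rcons -/(run _ _) -IHi.
Qed.

End Automaton.

Arguments automaton_fun {p} A p_pr s x.

(* Main.v *)
Require Import Defs.
From mathcomp Require Import all_boot all_order all_algebra.
From mathcomp Require Import boolp classical_sets functions cardinality.
From mathcomp Require Import fraction ring zify.
Local Open Scope classical_set_scope.
Local Open Scope ring_scope.

Set Implicit Arguments.
Unset Strict Implicit.
Unset Printing Implicit Defensive.

Import Order.TTheory GRing.Theory Num.Theory.
Import Defs.

(** Let s be the state reached from the initial state
   by a word w0 of length k0, and let a, b be words of length N, read as p-adic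
   integers.  It suffices to find an input x that begins with w0, carries the
   letters of a at positions K, ..., K + N - 1 for some K >= k0, and whose image
   F x carries the letters of b at these positions: the state reached after K
   letters of x is then reachable from s and turns a into b.

   Since f'' has finitely many zeros among the naturals, some natural n that
   begins with w0 has f'' n <> 0.  Take
     x = n' + p^k (1 + p^l a),   n' = n + p^m u,   K = k + l,
   where m is large, l is the valuation of p^m f'' n, and k is large in terms
   of n'.  The derivative at the single point n' gives
     F x = F n' + p^k f'(n') (1 + p^l a)   modulo p^(k + l + N).
   As F n' is a natural number below p^k, the digits of F x from position k + l
   on are those of f'(n') (1 + p^l a) from position l on.  The derivative of f'
   at n gives f'(n') = f'(n) + f''(n) p^m u modulo p^(l + N), and f''(n) p^m is
   p^l times a unit, so u can be chosen to give f'(n') any prescribed digits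
   at positions l, ..., l + N - 1 while those below l stay those of f'(n).
   In the product by 1 + p^l a the term 1 (the letter 1 that x carries after n')
   brings these free digits to positions l, ..., l + N - 1 of the output, and
   p^l a adds f'(n) a modulo p^N to them, a quantity known before u is chosen.

   This computation is lipschitz_orbit_dense; it concerns any map that is
   1-Lipschitz, that is, respects truncation.  The translation between words
   fed to an automaton and digits of its automaton function is made by
   pshift_automaton_fun and word_funE. *)

(** * Digits of p-adic integers *)

Section PadicShift.
Variables (p : nat) (p_pr : prime p).
Local Notation Zp := (padic_int p_pr).
Implicit Types (x y : Zp) (k n : nat).

Lemma trunc_subr_eq0 x y n : (trunc (x - y) n == 0%N) = (trunc x n == trunc y n).
Proof.
have := eqn_modDr (trunc y n) (trunc (x - y) n) 0 (p ^ n).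
by rewrite -truncD subrK add0n mod0n !modn_small ?trunc_lt.
Qed.

Lemma eq_truncW x y m n :
  (m <= n)%N -> trunc x n = trunc y n -> trunc x m = trunc y m.
Proof. by move=> mn e; rewrite -(trunc_mod x mn) e trunc_mod. Qed.

Lemma eq_trunc_digit x y n i :
  trunc x n = trunc y n -> (i < n)%N -> digit x i = digit y i.
Proof.
by move=> e lt_in; apply: ord_inj; rewrite !digit_trunc (eq_truncW lt_in e).
Qed.

Lemma eq_digit_trunc x y n :
  (forall i, (i < n)%N -> digit x i = digit y i) -> trunc x n = trunc y n.
Proof. by move=> e; apply: eq_bigr => i _; rewrite e. Qed.

Lemma truncD_pX x y m n :
  (m <= n)%N -> trunc (x + (p ^ n)%:R * y) m = trunc x m.
Proof.
move=> mn; rewrite truncD truncM truncMn (eqP (dvdn_exp2l p mn)) mul0n mod0n.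
by rewrite addn0 modn_small ?trunc_lt.
Qed.

Definition pshift k x : Zp := PadicInt p_pr (fun i => digit x (k + i)).

Lemma trunc_pshift k x n :
  trunc x (k + n) = (trunc x k + p ^ k * trunc (pshift k x) n)%N.
Proof.
elim: n => [|n IHn]; first by rewrite addn0 trunc0 muln0 addn0.
by rewrite addnS !truncS IHn /= expnD; ring.
Qed.

(** Division with remainder by a power of p: the digits below k form the
   remainder, the shifted word is the quotient. *)
Lemma pshiftK k x : (trunc x k)%:R + (p ^ k)%:R * pshift k x = x.
Proof.
apply: trunc_inj => n; rewrite truncD truncM !truncMn modnMml modnDml modnDmr.
by rewrite -trunc_pshift trunc_mod ?leq_addl.
Qed.

Lemma pshift_eq k x y n :
  trunc x (k + n) = trunc y (k + n) ->
  trunc (pshift k x) n = trunc (pshift k y) n.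
Proof.
move=> e; apply: eq_digit_trunc => i lt_in.
by rewrite /= (eq_trunc_digit e) // ltn_add2l.
Qed.

(** Uniqueness of that quotient and remainder; the prefix of an input or output
   word is thereby discarded once it is known to be a natural below p^k. *)
Lemma pshift_natD c k y : (c < p ^ k)%N -> pshift k (c%:R + (p ^ k)%:R * y) = y.
Proof.
move=> lt_c; have pk0 : (0 < p ^ k)%N by rewrite expn_gt0 prime_gt0.
set x := _ + _.
have Ex : trunc x k = c by rewrite truncD_pX // truncMn modn_small.
have := pshiftK k x; rewrite Ex /x => /addrI /mulfI; apply.
apply/eqP => /(congr1 (fun z => trunc z k.+1)); rewrite trunc0r truncMn modn_small.
  by move=> e; rewrite e in pk0.
by rewrite ltn_exp2l // prime_gt1.
Qed.

End PadicShift.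

(** * Calculus of small p-adic numbers *)

Section Small.
Variables (p : nat) (p_pr : prime p).
Local Notation Zp := (padic_int p_pr).
Local Notation Qp := (padic p_pr).
Implicit Types (x y : Zp) (q r : Qp) (k n m : nat).

Let p0 : (0 < p)%N := prime_gt0 p_pr.
Let pX0 n : (0 < p ^ n)%N. Proof. by rewrite expn_gt0 p0. Qed.
Let pXr0 n : 0 < p%:R ^+ n :> rat. Proof. by rewrite exprn_gt0 // ltr0n. Qed.

(** In terms of integers this says q \in p^n Z_p; stating it through the absolute
   value allows approximating a derivative by integers, modulo a power of p,
   before knowing that it is an integer. *)
Definition small n q : Prop := qpabs q <= p%:R ^- n.

Lemma smallD n q r : small n q -> small n r -> small n (q + r).
Proof.
by move=> sq sr; apply: le_trans (qpabsD q r) _; rewrite ge_max; apply/andP.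
Qed.

Lemma smallN n q : small n q -> small n (- q).
Proof. by rewrite /small qpabsN. Qed.

Lemma smallM n m q r : small n q -> small m r -> small (n + m) (q * r).
Proof.
by move=> sq sr; rewrite /small qpabsM exprD invfM ler_pM ?qpabs_ge0.
Qed.

Lemma smallW m n q : (m <= n)%N -> small n q -> small m q.
Proof.
move=> mn /le_trans; apply; rewrite lef_pV2 ?posrE ?pXr0 //.
by rewrite ler_weXn2l // ler1n.
Qed.

Lemma small_int n x : small n x%:Qp <-> trunc x n = 0%N.
Proof.
rewrite /small qpabs_int /zpabs; case: eqVneq => [->|x0].
  by rewrite trunc0r invr_ge0 ltW ?pXr0.
rewrite lef_pV2 ?posrE ?pXr0 // ler_eXn2l ?ltr1n ?prime_gt1 //.
by rewrite padic_val_ge //; split => /eqP.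
Qed.

Lemma small_intB n x y : small n (x%:Qp - y%:Qp) <-> trunc x n = trunc y n.
Proof.
rewrite -tofracB small_int.
by split=> /eqP; [rewrite trunc_subr_eq0|rewrite -trunc_subr_eq0] => /eqP.
Qed.

Lemma small0_int x : small 0 x%:Qp.
Proof. by apply/small_int; rewrite trunc0. Qed.

Lemma smallMr n q x : small n q -> small n (q * x%:Qp).
Proof. by move=> sq; rewrite -[n]addn0; apply: smallM (small0_int x). Qed.

Lemma qpabs_pX k : qpabs ((p ^ k)%:R : Zp)%:Qp = p%:R ^- k.
Proof. by rewrite qpabs_int zpabs_nat // pfactorK. Qed.

Lemma small_pX k : small k ((p ^ k)%:R : Zp)%:Qp.
Proof. by rewrite /small qpabs_pX. Qed.

Lemma small_cancel_pX n k q :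
  small (n + k) (q * ((p ^ k)%:R : Zp)%:Qp) -> small n q.
Proof.
by rewrite /small qpabsM qpabs_pX exprD invfM ler_pM2r // invr_gt0.
Qed.

(** Differentiability at x, cleared of denominators: relative to p^k, the
   remainder of the first-order expansion is at most p^-M. *)
Lemma padic_derive_approx (g : Zp -> Qp) x l : is_padic_derive g x l ->
  forall M, exists K, forall k y, (K <= k)%N ->
    small (M + k) (g (x + (p ^ k)%:R * y) - g x - l * ((p ^ k)%:R * y : Zp)%:Qp).
Proof.
move=> gl M; have eps0 : 0 < p%:R ^- M :> rat by rewrite invr_gt0.
have [d d0 Hd] := gl _ eps0; exists (Num.bound d^-1) => k y le_k.
have [->|y0] := eqVneq y 0.
  rewrite mulr0 addr0 subrr tofrac0 mulr0 subr0.
  by rewrite -tofrac0; apply/small_int/trunc0r.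
set h := _ * y.
have h0 : h != 0.
  by rewrite mulf_neq0 // -zpabs_eq0 zpabs_nat // invr_eq0 lt0r_neq0.
have sh : small k h%:Qp.
  by rewrite tofracM; apply/smallMr/small_pX.
have hd : zpabs (x + h - x) < d.
  rewrite addrC addKr; rewrite /small qpabs_int in sh; apply: le_lt_trans sh _.
  rewrite invf_plt ?posrE //.
  have := archi_boundP (_ : 0 <= d^-1); rewrite invr_ge0 ltW // => /(_ isT).
  move/lt_le_trans; apply; rewrite -natrX ler_nat (leq_trans le_k) // ltnW //.
  by rewrite ltn_expl // prime_gt1.
have hx : x + h != x by rewrite -subr_eq0 addrC addKr.
have := Hd _ hx hd; rewrite -tofracB.
rewrite [X in X%:Qp](_ : _ = h); last by rewrite addrC addKr.
move=> /ltW q_small.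
have hQ : h%:Qp != 0 by rewrite tofrac_eq0.
have -> : g (x + h) - g x - l * h%:Qp = ((g (x + h) - g x) / h%:Qp - l) * h%:Qp.
  by rewrite mulrBl divfK.
exact: smallM q_small sh.
Qed.

Lemma solve_mod (c d N : nat) : coprime c (p ^ N) ->
  exists u : nat, (c * u = d %[mod p ^ N])%N.
Proof.
move=> cN.
(* An integer that is 0 modulo c and d modulo p^N is c times a solution. *)
exists (chinese c (p ^ N) 0 d %/ c)%N.
have := chinese_modl cN 0 d; rewrite mod0n => /eqP dv.
by rewrite mulnC divnK // chinese_modr.
Qed.

(** A unit is invertible modulo p^N, hence its natural multiples fill all the
   residue classes. *)
Lemma padic_solve x y N : zpabs x = 1 ->
  exists u : nat, trunc (x * u%:R) N = trunc y N.
Proof.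
move=> x1.
have [u Hu] : exists u : nat, (trunc x N * u = trunc y N %[mod p ^ N])%N.
  apply: solve_mod; case: N => [|N]; first by rewrite coprimen1.
  rewrite coprime_pexpr // coprime_sym prime_coprime // /dvdn.
  rewrite -[X in (_ %% X)%N]expn1 trunc_mod //; apply/eqP => /small_int.
  rewrite /small qpabs_int x1 expr1 invf_ge1 ?ltr0n // lern1.
  by rewrite leqNgt prime_gt1.
exists u; rewrite truncM truncMn modnMmr Hu modn_small //; exact: trunc_lt.
Qed.

Lemma padic_factor x : x != 0 ->
  exists v x0, x = (p ^ v)%:R * x0 /\ zpabs x0 = 1.
Proof.
move=> x0; exists (padic_val x), (pshift (padic_val x) x).
have Ex : x = (p ^ padic_val x)%:R * pshift (padic_val x) x.
  rewrite -[LHS](pshiftK (padic_val x)).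
  have /eqP -> : trunc x (padic_val x) == 0%N by rewrite -padic_val_ge.
  by rewrite add0r.
split=> //; have := congr1 (@zpabs _ _) Ex.
rewrite zpabsM zpabs_nat // pfactorK // {1}/zpabs (negbTE x0).
rewrite -{1}[_ ^- _]mulr1 => /mulfI; rewrite invr_eq0 => /(_ (lt0r_neq0 (pXr0 _))).
by [].
Qed.

(** The multiples of a nonzero q by naturals u divisible by a fixed power of p
   approximate every multiple of p^w.  The exponents v and w are the valuations
   of a denominator and a numerator of q, so that w - v, possibly negative, is
   that of q; they depend neither on the target r nor on the precision N. *)
Lemma small_solve q : q != 0 -> exists v w : nat, forall (r : Zp) N,
  exists u : nat, small (w + N)
    (q * ((p ^ v)%:R * u%:R : Zp)%:Qp - ((p ^ w)%:R * r : Zp)%:Qp).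
Proof.
have [x [y [y0 ->]]] := padic_fracP q.
rewrite mulf_eq0 negb_or tofrac_eq0 => /andP[x0 _].
have [w [x1 [Ex ax]]] := padic_factor x0.
have [v [y1 [Ey ay]]] := padic_factor y0.
exists v, w => r N; have [u Hu] := padic_solve (r * y1) N ax; exists u.
have {}Hu : small N ((x1 * u%:R)%:Qp - (r * y1)%:Qp) by apply/small_intB.
have y1_0 : y1%:Qp != 0 :> Qp by rewrite tofrac_eq0 -zpabs_eq0 ay oner_eq0.
have pv0 : ((p ^ v)%:R : Zp)%:Qp != 0 :> Qp.
  by rewrite tofrac_eq0; apply: contraNneq y0; rewrite Ey => ->; rewrite mul0r.
rewrite Ex Ey !tofracM.
rewrite [X in small _ X](_ : _ =
  ((x1 * u%:R)%:Qp - (r * y1)%:Qp) / y1%:Qp * ((p ^ w)%:R : Zp)%:Qp).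
  rewrite addnC; apply: smallM _ (small_pX w); rewrite -[N]addn0; apply: smallM Hu _.
  rewrite /small -div1r -tofrac1 qpabs_div ?zpabs1 ?ay ?divr1 ?expr0 ?invr1 //.
  by rewrite -zpabs_eq0 ay oner_eq0.
rewrite !tofracM.
have field_id (K : fieldType) (P Q X Y U R : K) : P != 0 -> Y != 0 ->
    Q * X / (P * Y) * (P * U) - Q * R = (X * U - R * Y) / Y * Q.
  by move=> P0 Y0; field; rewrite P0 Y0.
exact: field_id.
Qed.

End Small.

(** * Twice differentiable 1-Lipschitz maps that preserve the naturals *)

Section LipschitzOrbit.
Variables (p : nat) (p_pr : prime p).
Local Notation Zp := (padic_int p_pr).
Local Notation Qp := (padic p_pr).
Variables (F : Zp -> Zp) (f' f'' : Zp -> Qp).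

Let p0 : (0 < p)%N := prime_gt0 p_pr.
Let pX0 n : (0 < p ^ n)%N. Proof. by rewrite expn_gt0 p0. Qed.

Hypothesis F_lip : forall x y n,
  trunc x n = trunc y n -> trunc (F x) n = trunc (F y) n.
Hypothesis F_nat : forall n : nat, exists m : nat, F n%:R = m%:R.
Hypothesis F_der : forall x, is_padic_derive (fun y => (F y)%:Qp) x (f' x).
Hypothesis f'_der : forall x, is_padic_derive f' x (f'' x).
Hypothesis f''_fin : finite_set [set n : nat | f'' n%:R = 0].

(** The difference quotients of a 1-Lipschitz map along powers of p are p-adic
   integers, and every p-adic integer is a limit of naturals. *)
Lemma lipschitz_derive_nat x M :
  exists c : nat, small M (f' x - (c%:R : Zp)%:Qp).
Proof.
have [K HK] := padic_derive_approx (F_der x) M.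
have := HK K 1 (leqnn K); rewrite mulr1; set P : Zp := (p ^ K)%:R => sK.
pose z := pshift K (F (x + P) - F x).
have Ez : F (x + P) - F x = P * z.
  rewrite -[LHS](pshiftK K) (_ : trunc _ K = 0%N) ?add0r //.
  apply/eqP; rewrite trunc_subr_eq0; apply/eqP/F_lip.
  by rewrite -[P]mulr1 truncD_pX.
exists (trunc z M).
have -> : f' x - ((trunc z M)%:R : Zp)%:Qp =
    - (z%:Qp - f' x) + (z%:Qp - ((trunc z M)%:R : Zp)%:Qp) by ring.
apply: smallD; last first.
  by apply/small_intB; rewrite truncMn modn_small ?trunc_lt.
apply: smallN; apply: (@small_cancel_pX _ _ M K).
have -> : (z%:Qp - f' x) * P%:Qp = (F (x + P))%:Qp - (F x)%:Qp - f' x * P%:Qp.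
  by rewrite mulrBl -tofracM (mulrC z P) -Ez tofracB.
exact: sK.
Qed.

Lemma derive2_neq0_near (c k : nat) :
  exists j : nat, f'' (c + p ^ k * j)%:R != 0.
Proof.
have /finite_seqP[s Es] := f''_fin.
exists (\sum_(i <- s) i).+1; apply/eqP => e0.
have : [set` s] (c + p ^ k * (\sum_(i <- s) i).+1)%N by rewrite -Es.
rewrite /=; set n := (c + _)%N => n_s.
have : (n <= \sum_(i <- s) i)%N by rewrite (big_rem n n_s) leq_addr.
rewrite leqNgt => /negP; apply; apply: leq_trans (leq_addl _ _).
by rewrite leq_pmull.
Qed.

(** The point x is n' + p^k (1 + p^l a): near the natural n, where f'' does not
   vanish, f' takes values with prescribed digits at far positions, and the
   letter 1 put after n' copies these digits of f'(n') into F x. *)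
Lemma lipschitz_orbit_dense (x0 a b : Zp) (k0 N : nat) :
  exists (x : Zp) (K : nat), [/\ (k0 <= K)%N, trunc x k0 = trunc x0 k0,
    pshift K x = a & trunc (pshift K (F x)) N = trunc b N].
Proof.
have [j] := derive2_neq0_near (trunc x0 k0) k0; set n : nat := (_ + _)%N => d2.
have [v [w solve]] := small_solve d2.
have [K1 HK1] := padic_derive_approx (f'_der n%:R) (w + N).
(* As f''(n) has valuation w - v, that of p^m f''(n) is l; and m0 is large
   enough for the expansion of f' at n to hold modulo p^(l + N), for n' to
   agree with n on k0 digits, and for N <= l. *)
pose m0 := (k0 + N + K1 + 1)%N; pose m := (m0 + v)%N; pose l := (m0 + w)%N.
have [c Hc] := lipschitz_derive_nat n%:R (l + N).
(* f'(n') is to be c + p^l r modulo p^(l + N).  Its product by 1 + p^l a then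
   has digits b from position l on, because a c and the digits of c from
   position l on have been subtracted. *)
pose r : Zp := b - a * c%:R - (c %/ p ^ l)%:R.
have [u Hu] := solve r N.
pose n' := (n + p ^ m * u)%N.
have f'n' : small (l + N) (f' n'%:R - (c%:R + (p ^ l)%:R * r : Zp)%:Qp).
  have sB : small (l + N)
      (f' n'%:R - f' n%:R - f'' n%:R * ((p ^ m)%:R * u%:R : Zp)%:Qp).
    rewrite natrD natrM; apply: smallW (HK1 m u%:R _); rewrite /l /m /m0; lia.
  have sC : small (l + N) (f'' n%:R * ((p ^ m)%:R * u%:R : Zp)%:Qp
      - ((p ^ l)%:R * r : Zp)%:Qp).
    have := smallM Hu (small_pX p_pr m0).
    rewrite (_ : w + N + m0 = l + N)%N; last by rewrite /l; lia.
    rewrite mulrBl -mulrA -!tofracM (mulrC _ (p ^ m0)%:R) (mulrC _ (p ^ m0)%:R).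
    by rewrite !mulrA -!natrM -!expnD.
  have -> : f' n'%:R - (c%:R + (p ^ l)%:R * r : Zp)%:Qp =
     (f' n'%:R - f' n%:R - f'' n%:R * ((p ^ m)%:R * u%:R : Zp)%:Qp)
     + (f'' n%:R * ((p ^ m)%:R * u%:R : Zp)%:Qp - ((p ^ l)%:R * r : Zp)%:Qp)
     + (f' n%:R - (c%:R : Zp)%:Qp).
    rewrite tofracD.
    have tele (V : comPzRingType) (x y z t s : V) :
        x - (s + t) = (x - y - z) + (z - t) + (y - s) by ring.
    exact: tele.
  by apply: smallD => //; apply: smallD.
have [fn' Efn'] := F_nat n'.
have [K2 HK2] := padic_derive_approx (F_der n'%:R) (l + N).
(* F n' < p^k is what keeps F n' from interfering with the digits in play. *)
pose k := (k0 + K2 + n' + fn')%N.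
pose h : Zp := 1 + (p ^ l)%:R * a.
have ltX z : (z <= k)%N -> (z < p ^ k)%N.
  by move=> zk; apply: leq_ltn_trans zk _; rewrite ltn_expl // prime_gt1.
have ltXD y z :
    (y < p ^ k)%N -> (z < p ^ l)%N -> (y + p ^ k * z < p ^ (k + l))%N.
  move=> yk zl; rewrite expnD (@leq_trans (p ^ k * z.+1)) //.
    by rewrite mulnS ltn_add2r.
  by rewrite leq_mul2l zl orbT.
pose x : Zp := n'%:R + (p ^ k)%:R * h.
have Ex : x = (n' + p ^ k * 1)%:R + (p ^ (k + l))%:R * a.
  by rewrite /x /h expnD natrD muln1 natrM mulrDr mulr1 addrA mulrA.
have l_gt0 : (0 < l)%N by rewrite /l /m0; lia.
have le_Nl : (N <= l)%N by rewrite /l /m0; lia.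
have EFx : trunc (F x) (k + l + N) =
    trunc ((fn' + p ^ k * (c %% p ^ l))%:R + (p ^ (k + l))%:R * b) (k + l + N).
  apply/small_intB.
  have sA : small (k + l + N)
      ((F x)%:Qp - (F n'%:R)%:Qp - f' n'%:R * ((p ^ k)%:R * h : Zp)%:Qp).
    by apply: smallW (HK2 k h _); rewrite /k; lia.
  have sB : small (k + l + N)
      ((f' n'%:R - (c%:R + (p ^ l)%:R * r : Zp)%:Qp)
       * ((p ^ k)%:R * h : Zp)%:Qp).
    rewrite -addnA addnC tofracM; apply: smallM f'n' _.
    exact/smallMr/small_pX.
  have sC : small (k + l + N) ((p ^ (k + l + l))%:R * (a * r) : Zp)%:Qp.
    rewrite tofracM; apply/smallMr/(smallW _ (small_pX _ _)).
    by rewrite leq_add2l.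
  move: (smallD (smallD sA sB) sC); congr (small _ _); apply: esym.
  (* C and Q stand for the remainder and the quotient of c by p^l; the last
     term is the product of the two corrections of order p^l. *)
  have expand (K : comPzRingType) (X Y D P L Q C A B : K)
        (R := B - A * (Q * L + C) - Q) :
      X - (Y + P * C + P * L * B) = (X - Y - D * (P * (1 + L * A)))
        + (D - (Q * L + C + L * R)) * (P * (1 + L * A)) + P * L * L * (A * R).
    by rewrite /R; ring.
  have Ec : c%:R = (c %/ p ^ l)%:R * (p ^ l)%:R + (c %% p ^ l)%:R :> Zp.
    by rewrite -natrM -natrD -divn_eq.
  rewrite Efn' /r /h Ec !expnD !natrD !natrM !(tofracB, tofracD, tofracM) tofrac1.
  exact: expand.
exists x, (k + l)%N; split.
- by rewrite /k; lia.
- rewrite /x truncD_pX; last by rewrite /k; lia.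
  rewrite /n' natrD natrM truncD_pX; last by rewrite /m /m0; lia.
  by rewrite /n natrD natrM truncD_pX // truncMn modn_small ?trunc_lt.
- rewrite Ex pshift_natD // ltXD ?ltX //; first by rewrite /k; lia.
  by rewrite -{1}(expn0 p) ltn_exp2l ?prime_gt1.
- by rewrite (pshift_eq EFx) pshift_natD // ltXD ?ltX ?ltn_mod //; rewrite /k; lia.
Qed.

End LipschitzOrbit.

(** * Words fed to an automaton, as digits *)

Section AutomatonWords.
Variables (p : nat) (p_pr : prime p) (A : automaton p).
Local Notation Zp := (padic_int p_pr).
Implicit Types (s t : state A) (x y : Zp) (w : seq 'I_p).

Lemma run_cat s w1 w2 : run s (w1 ++ w2) = run (run s w1) w2.
Proof. exact: foldl_cat. Qed.

(** After k letters the automaton goes on as the one started in the state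
   reached, fed with the rest of the word. *)
Lemma pshift_automaton_fun s x k :
  pshift k (automaton_fun A p_pr s x) =
  automaton_fun A p_pr (state_at s (digit x) k) (pshift k x).
Proof.
congr PadicInt; apply/funext => i /=; congr outp.
by elim: i => [|i IHi]; rewrite ?addn0 //= addnS /= IHi.
Qed.

Lemma mkseq_digit_cat x k i :
  mkseq (digit x) (k + i) = mkseq (digit x) k ++ mkseq (digit (pshift k x)) i.
Proof.
rewrite /mkseq iotaD add0n map_cat; congr (_ ++ _).
by rewrite -{1}[k]addn0 iotaDl -map_comp.
Qed.

Lemma eq_trunc_mkseq x y n :
  trunc x n = trunc y n -> mkseq (digit x) n = mkseq (digit y) n.
Proof.
move=> e; apply/eq_in_map => i; rewrite mem_iota add0n => /= lt_in.
exact: eq_trunc_digit e lt_in.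
Qed.

Lemma automaton_fun_lipschitz s x y n : trunc x n = trunc y n ->
  trunc (automaton_fun A p_pr s x) n = trunc (automaton_fun A p_pr s y) n.
Proof.
move=> e; apply: eq_digit_trunc => i lt_in /=; rewrite !state_at_run.
rewrite (eq_trunc_digit e lt_in).
by rewrite (eq_trunc_mkseq (eq_truncW (ltnW lt_in) e)).
Qed.

(** Padding with zeros makes a finite word an argument of automaton_fun. *)
Definition padic_of_word w : Zp :=
  PadicInt p_pr (nth (Ordinal (prime_gt0 p_pr)) w).

Lemma mkseq_padic_of_word w : mkseq (digit (padic_of_word w)) (size w) = w.
Proof. exact: mkseq_nth. Qed.

Lemma word_funE n t (w : n.-tuple 'I_p) :
  word_fun t w =
    mkseq (digit (automaton_fun A p_pr t (padic_of_word w))) n :> seq _.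
Proof.
set x0 := Ordinal (prime_gt0 p_pr).
apply: (@eq_from_nth _ x0) => [|i]; rewrite size_tuple ?size_mkseq // => lt_in.
rewrite nth_mkseq //= state_at_run.
have -> : nth x0 (word_fun t w) i = tnth (word_fun t w) (Ordinal lt_in).
  by rewrite (tnth_nth x0).
rewrite tnth_mktuple (tnth_nth x0) /=; congr outp; congr run.
rewrite -[X in take _ X]mkseq_padic_of_word size_tuple /mkseq -map_take.
by rewrite take_iota (minn_idPl (ltnW lt_in)).
Qed.

End AutomatonWords.

Theorem corollary4p6 (p : nat) (p_pr : prime p) (A : automaton p)
    (f' f'' : padic_int p_pr -> padic p_pr) :
  (forall t : state A, reachable (init A) t) ->
  (forall n : nat, exists m : nat,
     automaton_fun A p_pr (init A) n%:R = m%:R) ->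
  (forall x : padic_int p_pr,
     is_padic_derive (fun y => (automaton_fun A p_pr (init A) y)%:Qp) x (f' x)) ->
  (forall x : padic_int p_pr, is_padic_derive f' x (f'' x)) ->
  finite_set [set n : nat | f'' n%:R = 0] ->
  absolutely_transitive A.
Proof.
move=> reach F_nat F_der f'_der f''_fin s n _ a b.
have [w0 <-] := reach s.
have [x [K [le_K x_w0 x_a Fx_b]]] :=
  lipschitz_orbit_dense (@automaton_fun_lipschitz _ p_pr A (init A)) F_nat F_der
    f'_der f''_fin (padic_of_word p_pr w0) (padic_of_word p_pr a)
    (padic_of_word p_pr b) (size w0) n.
exists (word_fun (state_at (init A) (digit x) K)).
  exists (state_at (init A) (digit x) K) => //.
  exists (mkseq (digit (pshift (size w0) x)) (K - size w0)).
  rewrite -[X in run (run _ X)](mkseq_padic_of_word p_pr w0).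
  rewrite -(eq_trunc_mkseq x_w0) -run_cat -mkseq_digit_cat subnKC //.
  by rewrite state_at_run.
apply: val_inj; rewrite /= (word_funE p_pr) -x_a -pshift_automaton_fun.
rewrite (eq_trunc_mkseq Fx_b) -{2}(mkseq_padic_of_word p_pr b).
by rewrite size_tuple.
Qed.
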